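(* Given $0<p<q<\infty$, there is a $\varphi$-function $G$ such that $p_m(G)=p$, $q_m(G)=q$, $p(L_{1,G})=p/q$ and $q(L_{1,G})=q/p$.
   Context: A $\varphi$-function is a continuous, strictly increasing function $F:[0,\infty)\to[0,\infty)$ with $F(0)=0$ and $\lim_{t\to\infty}F(t)=\infty$. For a $\varphi$-function $F$ put $\tilde F(t)=1/F(1/t)$ for $t>0$ and $\tilde F(0)=0$. All functions live on $[0,\infty)$ with Lebesgue measure $\lambda$; $f^*(x)=\sup\{t:\lambda(|f|\ge t)\ge x\}$. Luxemburg functional: $\|f\|_G=\inf\{c>0:\int_0^\infty G(|f(x)|/c)\,dx\le1\}$. Orlicz--Lorentz functional: $\|f\|_{F,G}=\|f^*\circ\tilde F\circ\tilde G^{-1}\|_G$, space $L_{F,G}=\{f:\|f\|_{F,G}<\infty\}$; $L_{1,G}$ denotes $L_{T^1,G}$ where $T^1(t)=t$, so $\|f\|_{1,G}=\|f^*\circ\tilde G^{-1}\|_G$. Dilation operators $d_af(x)=f(ax)$ with $\|d_a\|_{X\to X}=\sup\{\|d_af\|_X/\|f\|_X:0<\|f\|_X<\infty\}$. Lower Boyd index $p(X)=\sup\{p:\exists c<\infty,\ \|d_a\|_{X\to X}\le c\,a^{-1/p}\ \forall a<1\}$; upper Boyd index $q(X)=\inf\{q:\exists c<\infty,\ \|d_a\|_{X\to X}\le c\,a^{-1/q}\ \forall a>1\}$. Matuszewska--Orlicz indices: $p_m(G)=\sup\{p:\exists c>0,\ G(at)\ge c\,a^pG(t)\ \forall t\ge0,\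 a>1\}$, $q_m(G)=\inf\{q:\exists c<\infty,\ G(at)\le c\,a^qG(t)\ \forall t\ge0,\ a>1\}$. *)

(* Defs.v *)
From HB Require Import structures.
From mathcomp Require Import all_boot all_order all_algebra.
From mathcomp Require Import all_classical all_reals all_analysis.
Set Implicit Arguments. Unset Strict Implicit. Unset Printing Implicit Defensive.
Import Order.TTheory GRing.Theory Num.Theory.
Import numFieldNormedType.Exports.
Local Open Scope classical_set_scope.
Local Open Scope ring_scope.

Section Defs.
Variable R : realType.

Definition halfline : set R := `[0, +oo[%classic.

Definition phi_function (F : R -> R) : Prop :=
  [/\ {within `[0, +oo[, continuous F},
      (forall x y : R, 0 <= x -> x < y -> F x < F y),
      F 0 = 0 &
      F x @[x --> +oo] --> +oo].

Definition tilde (F : R -> R) : R -> R :=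
  fun t => if t == 0 then 0 else (F t^-1)^-1.

(* inverse of a phi-function on [0,oo): F^{-1}(y) = sup {t >= 0 | F t <= y}
   (for a phi-function this is the genuine inverse function) *)
Definition phi_inv (F : R -> R) : R -> R :=
  fun y => sup [set t : R | 0 <= t /\ F t <= y].

Definition dec_rearr (f : R -> R) (x : R) : \bar R :=
  ereal_sup [set (t%:E)%E | t in [set t : R |
     (x%:E <= (@lebesgue_measure R) (setI halfline [set y | (t <= `|f y|)%R]))%E]].

(* extension of G to \bar R (the argument is always >= 0 in use) *)
Definition ext_phi (G : R -> R) (e : \bar R) : \bar R :=
  match e with
  | EFin r => (G r)%:E
  | +oo%E => +oo%E
  | -oo%E => 0%E
  end.

Definition luxemburg (G : R -> R) (g : R -> \bar R) : \bar R :=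
  ereal_inf [set (c%:E)%E | c in [set c : R | 0 < c /\
     (\int[(@lebesgue_measure R)]_(x in halfline)
        ext_phi G (`|g x| * (c^-1)%:E)%E <= 1)%E]].

Definition OL_norm (F G : R -> R) (f : R -> R) : \bar R :=
  luxemburg G (fun x => dec_rearr f (tilde F (phi_inv (tilde G) x))).

Definition L1G_norm (G : R -> R) : (R -> R) -> \bar R := OL_norm (fun t => t) G.

Definition dilation (a : R) (f : R -> R) : R -> R := fun x => f (a * x).

(* operator norm of d_a on the space X = {f measurable on [0,oo) | ||f||_X < oo}:
   sup { ||d_a f||_X / ||f||_X : 0 < ||f||_X < oo } *)
Definition dil_norm (N : (R -> R) -> \bar R) (a : R) : \bar R :=
  ereal_sup [set (N (dilation a f) * ((fine (N f))^-1)%:E)%E | f in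
     [set f : R -> R | measurable_fun halfline f /\
        (0 < N f)%E /\ (N f < +oo)%E]].

Definition boyd_lower (N : (R -> R) -> \bar R) : \bar R :=
  ereal_sup [set (p%:E)%E | p in [set p : R | 0 < p /\ exists c : R,
     forall a : R, 0 < a -> a < 1 -> (dil_norm N a <= (c * a `^ (- p^-1))%:E)%E]].

Definition boyd_upper (N : (R -> R) -> \bar R) : \bar R :=
  ereal_inf [set (q%:E)%E | q in [set q : R | 0 < q /\ exists c : R,
     forall a : R, 1 < a -> (dil_norm N a <= (c * a `^ (- q^-1))%:E)%E]].

Definition MO_lower (G : R -> R) : \bar R :=
  ereal_sup [set (p%:E)%E | p in [set p : R | exists2 c : R, 0 < c &
     forall t a : R, 0 <= t -> 1 < a -> c * a `^ p * G t <= G (a * t)]].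

Definition MO_upper (G : R -> R) : \bar R :=
  ereal_inf [set (q%:E)%E | q in [set q : R | exists c : R,
     forall t a : R, 0 <= t -> 1 < a -> G (a * t) <= c * a `^ q * G t]].

End Defs.

(* Main.v *)
Require Import Defs.
From HB Require Import structures.
From mathcomp Require Import all_boot all_order all_algebra.
From mathcomp Require Import all_classical all_reals all_analysis.
From mathcomp Require Import measurable_realfun ring lra.
Set Implicit Arguments.
Unset Strict Implicit.
Unset Printing Implicit Defensive.
Import Order.TTheory GRing.Theory Num.Theory.
Import numFieldNormedType.Exports.
Local Open Scope ring_scope.

(**
In the coordinate [v = ln t], take [ln G] piecewise linear with slopes [p] and
[q] alternating on blocks whose lengths tend to infinity. The bounds
[a^p G(t) <= G(a t) <= a^q G(t)] for [a >= 1] pass to [tilde G], and, after a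
linear change of variables in the modular, give [||d_a|| <= a^(-q/p)] for
[a < 1] and [||d_a|| <= a^(-p/q)] for [a > 1].

Indicator functions satisfy [||1_A||_{1,G} = |A|], so they do not witness
sharpness. Instead let [f = max_(k < N) y_k 1_[0, 1/x_k]] with the [y_k] far
apart: up to a factor 2, the modular of [d_a f] at [c] is
[\sum_k G(y_k / c) / G(a x_k)]. For [a = 1/b < 1] put each [y_k] at a point
where a slope-[p] block ends and a slope-[q] block begins, [x_k = b y_k] and
[N ~ b^q]: passing from [f] to [d_a f] multiplies each term by [b^q], and only
[c ~ b^(q/p)] compensates for this. For [a > 1] put [x_k] where a slope-[q]
block ends and a slope-[p] block begins, [y_k = x_k / D] and [N ~ D^q] with
[D ~ a^(p/q)].
*)

(** * Lebesgue measure under scaling, and measurability of monotone functions *)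

Section Lebesgue.
Context {R : realType}.
Local Open Scope classical_set_scope.
Local Notation mu := (@lebesgue_measure R).

(** [a] times the pushforward of Lebesgue measure under multiplication by [a] agrees with it on
    half-open intervals, so uniqueness of Lebesgue measure applies. *)
Lemma lebesgue_measure_preimage_mulr (a : R) (A : set R) : 0 < a ->
  measurable A -> mu ( *%R a @^-1` A) = ((a^-1)%:E * mu A)%E.
Proof.
move=> a0 mA.
have ma : measurable_fun setT ( *%R a : measurableTypeR R -> measurableTypeR R).
  exact: mulrl_measurable.
pose m : {measure set (measurableTypeR R) -> \bar R} := mscale (NngNum (ltW a0))
  (pushforward mu ( *%R a : measurableTypeR R -> measurableTypeR R)).
have -> : mu A = (a%:E * mu ( *%R a @^-1` A))%E.
  rewrite (@lebesgue_measure_unique R (m ma))// => _ [[x y] _ <-].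
  rewrite /m /= /mscale /= /pushforward.
  rewrite [X in (_ * _ X)%E](_ : _ = `]x / a, y / a]%classic); last first.
    apply/seteqP; split => z /=; rewrite !in_itv /= ler_pdivlMr// ltr_pdivrMr//;
      by rewrite mulrC.
  rewrite !lebesgue_measure_itv /= !lte_fin ltr_pM2r ?invr_gt0//.
  case: ifP => _; last by rewrite mule0.
  by rewrite -!EFinB -EFinM -mulrBl mulrC divfK// gt_eqF.
by rewrite muleA -EFinM mulVf ?gt_eqF// mul1e.
Qed.

Lemma ge0_integral_mulr (a : R) (f : R -> \bar R) : 0 < a ->
  measurable_fun (`]0, +oo[ : set R) f -> (forall x, 0 < x -> (0 <= f x)%E) ->
  (\int[mu]_(x in `]0%R, +oo[) f (a * x)%R =
   (a^-1)%:E * \int[mu]_(x in `]0%R, +oo[) f x)%E.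
Proof.
move=> a0 mf f0.
have ma : measurable_fun setT ( *%R a : measurableTypeR R -> measurableTypeR R).
  exact: mulrl_measurable.
have ai0 : 0 <= a^-1 by rewrite invr_ge0 ltW.
have preE : `]0, +oo[ = *%R a @^-1` `]0, +oo[%classic :> set R.
  by apply/seteqP; split => z /=; rewrite !in_itv /= !andbT pmulr_rgt0.
have f0' x : `]0, +oo[%classic x -> (0 <= f x)%E.
  by rewrite /= in_itv /= andbT; exact: f0.
transitivity (\int[pushforward mu
    ( *%R a : measurableTypeR R -> measurableTypeR R)]_(x in `]0%R, +oo[) f x)%E.
  rewrite ge0_integral_pushforward//; first by rewrite -preE.
  by move=> x; rewrite inE; exact: f0'.
rewrite (@eq_measure_integral _ _ _ _ (mscale (NngNum ai0) mu)) => [|A mA _].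
  by rewrite ge0_integral_mscale.
exact: lebesgue_measure_preimage_mulr.
Qed.

(** Superlevel sets of a monotone function are intervals. This covers all modular integrands, which
    may take the value [+oo]. *)
Lemma nonincreasing_emeasurable (f : R -> \bar R) :
  (forall x y, 0 < x -> x <= y -> (f y <= f x)%E) ->
  measurable_fun (`]0, +oo[ : set R) f.
Proof.
move=> fni mD; apply: (measurability _ (ErealGenCInfty.measurableE R)) => //.
move=> _ [_ [r ->] <-]; apply: is_interval_measurable => s t /=.
rewrite !in_itv /= !andbT => -[s0 fs] [t0 ft] u /andP[su ut].
have u0 : 0 < u by exact: lt_le_trans su.
by split; rewrite /= in_itv /= andbT// (le_trans ft)// fni.
Qed.

End Lebesgue.

(** * Decreasing rearrangement: monotonicity, dilation, two-sided estimates *)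

Section Rearrangement.
Context {R : realType}.
Local Open Scope classical_set_scope.
Local Notation mu := (@lebesgue_measure R).
Implicit Types (f : R -> R) (x y t : R).

(** The level 0 is always admissible, because the half-line has infinite measure. *)
Lemma dec_rearr_ge0 f x : (0 <= dec_rearr f x)%E.
Proof.
apply: ereal_sup_ubound; exists 0 => //=.
have -> : @halfline R `&` [set y | 0 <= `|f y|] = @halfline R.
  by apply/seteqP; split => z //= -[].
by rewrite lebesgue_measure_itv/= ltry leey.
Qed.

Lemma dec_rearr_anti f x y : x <= y -> (dec_rearr f y <= dec_rearr f x)%E.
Proof.
move=> xy; apply: ereal_sup_le => _ [t /= yt <-]; exists t => //=.
by apply: le_trans yt; rewrite lee_fin.
Qed.

Lemma measurable_superlevel f t : measurable_fun (@halfline R) f ->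
  measurable (@halfline R `&` [set y | t <= `|f y|]).
Proof.
move=> mf; have mh : measurable (@halfline R) by exact: measurable_itv.
have /measurable_EFinP mnf := measurableT_comp (@normr_measurable R setT) mf.
exact: (emeasurable_fun_c_infty mh mnf t%:E).
Qed.

Lemma dec_rearr_dilation (a : R) f x : 0 < a ->
  measurable_fun (@halfline R) f ->
  dec_rearr (dilation a f) x = dec_rearr f (a * x).
Proof.
move=> a0 mf; congr (ereal_sup (EFin @` _)); apply/funext => t /=.
have -> : @halfline R `&` [set y | t <= `|dilation a f y|] =
    *%R a @^-1` (@halfline R `&` [set y | t <= `|f y|]).
  by apply/seteqP; split => y /=; rewrite /halfline /= !in_itv /= !andbT pmulr_rge0.
rewrite lebesgue_measure_preimage_mulr ?lee_pdivlMl//.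
exact: measurable_superlevel.
Qed.

(** A level above [M] confines the superlevel set to [[0, r]], whose measure is too small. The
    strict [r < x] matters because the rearrangement is defined with a non-strict inequality. *)
Lemma dec_rearr_le f x M r : measurable_fun (@halfline R) f ->
  0 <= M -> 0 <= r -> r < x ->
  (forall y, r < y -> `|f y| <= M) -> (dec_rearr f x <= M%:E)%E.
Proof.
move=> mf M0 r0 rx fM; apply/ereal_supP => _ [t /= xt <-]; rewrite lee_fin.
rewrite leNgt; apply/negP => Mt; move: xt; apply/negP; rewrite -ltNge.
apply: (@le_lt_trans _ _ (mu `[0, r])); last first.
  rewrite lebesgue_measure_itv/= lte_fin; case: ifP => _; rewrite lte_fin ?subr0//.
  exact: le_lt_trans rx.
apply: le_measure; rewrite ?inE//; first exact: measurable_superlevel.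
move=> y [] /=; rewrite /halfline /= !in_itv /= andbT => -> ty /=.
by rewrite leNgt; apply/negP => /fM; rewrite leNgt (lt_le_trans Mt).
Qed.

Lemma dec_rearr_ge f x t r : measurable_fun (@halfline R) f -> x <= r ->
  (forall y, 0 <= y <= r -> t <= `|f y|) -> (t%:E <= dec_rearr f x)%E.
Proof.
move=> mf xr ft; apply: ereal_sup_ubound; exists t => //=.
apply: (@le_trans _ _ (mu `[0, r])).
  rewrite lebesgue_measure_itv/= lte_fin; case: ltP => r0; rewrite lee_fin ?subr0//.
  exact: le_trans r0.
apply: le_measure; rewrite ?inE//; first exact: measurable_superlevel.
move=> y /=; rewrite /halfline /= !in_itv /= andbT => yr; split; last exact: ft.
by case/andP: yr.
Qed.

End Rearrangement.

(** * Functions with two-sided power growth and their inverses *)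

Lemma powR_gt1 {R : realType} (a r : R) : 1 < a -> 0 < r -> 1 < a `^ r.
Proof.
move=> a1 r0; have a0 := lt_trans ltr01 a1.
have := @gt0_ltr_powR R r r0 1 a; rewrite powR1; apply => //.
  by rewrite nnegrE.
by rewrite nnegrE ltW.
Qed.


Lemma powRVK {R : realType} (x r : R) : 0 <= x -> r != 0 -> (x `^ r^-1) `^ r = x.
Proof. by move=> x0 r0; rewrite -powRrM mulVf// powRr1. Qed.

(** Says that all slopes of [ln G] against [ln t] lie in [[p, q]]. The upper bounds on dilations
    rest on this alone; the block structure enters only when sharpness is shown. *)
Definition power_growth {R : realType} (p q : R) (G : R -> R) : Prop :=
  [/\ G 0 = 0, (forall t : R, 0 < t -> 0 < G t),
      (forall t a : R, 0 <= t -> 1 <= a -> a `^ p * G t <= G (a * t)) &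
      (forall t a : R, 0 <= t -> 1 <= a -> G (a * t) <= a `^ q * G t)].

Section PowerGrowth.
Context {R : realType}.
Local Open Scope classical_set_scope.
Variables (p q : R) (G : R -> R).
Hypotheses (p0 : 0 < p) (q0 : 0 < q) (GP : power_growth p q G).

Let G0 : G 0 = 0. Proof. by case: GP. Qed.
Let G_gt0 (t : R) : 0 < t -> 0 < G t. Proof. by case: GP => _ + _ _; apply. Qed.
Let G_low (t a : R) : 0 <= t -> 1 <= a -> a `^ p * G t <= G (a * t).
Proof. by case: GP => _ _ + _; apply. Qed.
Let G_up (t a : R) : 0 <= t -> 1 <= a -> G (a * t) <= a `^ q * G t.
Proof. by case: GP => _ _ _; apply. Qed.

Lemma power_growth_ge0 (t : R) : 0 <= t -> 0 <= G t.
Proof. by rewrite le_eqVlt => /predU1P[<-|/G_gt0/ltW//]; rewrite G0. Qed.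

Lemma power_growth_lt (s t : R) : 0 <= s -> s < t -> G s < G t.
Proof.
rewrite le_eqVlt => /predU1P[<- t0|s0 st]; first by rewrite G0 G_gt0.
have st1 : 1 < t / s by rewrite ltr_pdivlMr ?mul1r.
have := G_low (ltW s0) (ltW st1); rewrite divfK ?gt_eqF//; apply: lt_le_trans.
by rewrite ltr_pMl ?G_gt0// powR_gt1.
Qed.

Lemma power_growth_le (s t : R) : 0 <= s -> s <= t -> G s <= G t.
Proof.
by move=> s0; rewrite le_eqVlt => /predU1P[->//|st]; exact/ltW/power_growth_lt.
Qed.

Lemma power_growth_contract (t a : R) : 0 <= t -> 0 < a <= 1 ->
  G (a * t) <= a `^ p * G t.
Proof.
move=> t0 /andP[a0 a1]; have at0 : 0 <= a * t by rewrite mulr_ge0// ltW.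
have ai1 : 1 <= a^-1 by rewrite invf_ge1.
have := G_low at0 ai1; rewrite mulKf ?gt_eqF// -(ler_pM2l (powR_gt0 p a0)).
by rewrite mulrA -powRM ?invr_ge0 ?(ltW a0)// divff ?gt_eqF// powR1 mul1r.
Qed.

Lemma power_growth_contract_ge (t a : R) : 0 <= t -> 0 < a <= 1 ->
  a `^ q * G t <= G (a * t).
Proof.
move=> t0 /andP[a0 a1]; have at0 : 0 <= a * t by rewrite mulr_ge0// ltW.
have ai1 : 1 <= a^-1 by rewrite invf_ge1.
have := G_up at0 ai1; rewrite mulKf ?gt_eqF// -(ler_pM2l (powR_gt0 q a0)).
by rewrite mulrA -powRM ?invr_ge0 ?(ltW a0)// divff ?gt_eqF// powR1 mul1r.
Qed.

Lemma tildeE (s : R) : 0 < s -> tilde G s = (G s^-1)^-1.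
Proof. by move=> s0; rewrite /tilde gt_eqF. Qed.

(** In logarithmic coordinates [tilde] is the reflection through the origin, which preserves
    slopes. *)
Lemma power_growth_tilde : power_growth p q (tilde G).
Proof.
have T0 : tilde G 0 = 0 by rewrite /tilde eqxx.
have T_gt0 (t : R) : 0 < t -> 0 < tilde G t.
  by move=> t0; rewrite tildeE// invr_gt0 G_gt0// invr_gt0.
split => // t a; rewrite le_eqVlt => /predU1P[<-|t0] a1; rewrite ?mulr0 ?T0 ?mulr0//.
all: have a0 := lt_le_trans ltr01 a1; have at0 : 0 < a * t by rewrite mulr_gt0.
all: have ti0 : 0 < t^-1 by rewrite invr_gt0.
all: have ai : 0 < a^-1 <= 1 by rewrite invr_gt0 a0 invf_le1.
all: have Gt := G_gt0 ti0; have Gat : 0 < G (a^-1 * t^-1).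
1,3: by rewrite G_gt0// mulr_gt0// invr_gt0.
all: rewrite !tildeE// invfM.
- rewrite -[a `^ p]invrK -powRN -mulN1r powRrM powR_inv1 ?(ltW a0)// -[leLHS]invfM.
  rewrite lef_pV2 ?posrE ?mulr_gt0 ?powR_gt0 ?invr_gt0//.
  by rewrite power_growth_contract// ltW.
- rewrite -[a `^ q]invrK -powRN -mulN1r powRrM powR_inv1 ?(ltW a0)// -[leRHS]invfM.
  rewrite lef_pV2 ?posrE ?mulr_gt0 ?powR_gt0 ?invr_gt0//.
  by rewrite power_growth_contract_ge// ltW.
Qed.

Lemma power_growth_surj_ge (x : R) : exists2 s, 0 < s & x <= G s.
Proof.
(* Solves [s ^ p * G 1 = x], truncated below at 1 so that the growth bound from the point 1
   applies. *)
pose s := Num.max 1 ((x / G 1) `^ p^-1).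
have s1 : 1 <= s by rewrite /s le_max lexx.
exists s; first exact: lt_le_trans s1.
have := G_low ler01 s1; rewrite mulr1; apply: le_trans.
rewrite -ler_pdivrMr ?G_gt0//.
have [x0|x0] := leP (x / G 1) 0; first exact: le_trans (powR_ge0 _ _).
rewrite -[leLHS](@powRVK _ _ p) ?(ltW x0) ?gt_eqF//.
apply: ge0_ler_powR; rewrite ?nnegrE ?powR_ge0 ?(ltW p0)//.
  exact: le_trans s1.
by rewrite /s le_max lexx orbT.
Qed.

Lemma power_growth_surj_le (x : R) : 0 < x -> exists2 s, 0 < s & G s <= x.
Proof.
move=> x0; pose s := Num.min 1 ((x / G 1) `^ p^-1).
have xG : 0 < x / G 1 by rewrite divr_gt0 ?G_gt0.
have s0 : 0 < s by rewrite /s lt_min ltr01 powR_gt0.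
exists s => //.
have s1 : 0 < s <= 1 by rewrite s0 /s ge_min lexx.
have := power_growth_contract ler01 s1; rewrite mulr1 => /le_trans; apply.
rewrite -ler_pdivlMr ?G_gt0//.
rewrite -[leRHS](@powRVK _ _ p) ?(ltW xG) ?gt_eqF//.
apply: ge0_ler_powR; rewrite ?nnegrE ?powR_ge0 ?(ltW p0) ?(ltW s0)//.
by rewrite /s ge_min lexx orbT.
Qed.

Lemma le_phi_inv (x s : R) : 0 < s -> G s <= x -> s <= phi_inv G x.
Proof.
move=> s0 Gsx; apply: ub_le_sup => /=; last by split; [exact: ltW|].
have [b b0 xb] := power_growth_surj_ge x; exists b => t [t0 Gtx].
rewrite leNgt; apply/negP => /(power_growth_lt (ltW b0)).
by rewrite ltNge (le_trans Gtx).
Qed.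

Lemma phi_inv_gt0 (x : R) : 0 < x -> 0 < phi_inv G x.
Proof.
move=> /power_growth_surj_le[s s0 Gsx].
exact: lt_le_trans (le_phi_inv s0 Gsx).
Qed.

(** The Galois connection through which the inverse is handled from here on. The upper growth bound
    does the work of continuity: if [G s < x], there is room to enlarge [s] by a factor above 1. *)
Lemma phi_inv_le (x s : R) : 0 < x -> 0 < s -> (phi_inv G x <= s) = (x <= G s).
Proof.
move=> x0 s0; apply/idP/idP => [|xs]; last first.
  apply: ge_sup => /=; first by exists 0; rewrite /= G0; split => //; exact: ltW.
  move=> t [t0 Gtx]; rewrite leNgt; apply/negP => /(power_growth_lt (ltW s0)).
  by rewrite ltNge (le_trans Gtx).
apply: contraTT; rewrite -!ltNge => Gsx; have Gs0 := G_gt0 s0.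
(* Chosen so that [a ^ q * G s = x], hence [G (a * s) <= x]. *)
pose a := (x / G s) `^ q^-1.
have a1 : 1 < a by rewrite powR_gt1 ?invr_gt0// ltr_pdivlMr// mul1r.
apply: (@lt_le_trans _ _ (a * s)); first by rewrite ltr_pMl.
apply: le_phi_inv; first by rewrite mulr_gt0// (lt_trans _ a1).
apply: (le_trans (G_up (ltW s0) (ltW a1))).
by rewrite powRVK ?gt_eqF ?divr_ge0 ?(ltW x0) ?(ltW Gs0)// divfK ?gt_eqF.
Qed.

Lemma phi_inv_homo (x y : R) : 0 < x -> x <= y -> phi_inv G x <= phi_inv G y.
Proof.
move=> x0 xy; have y0 := lt_le_trans x0 xy; have Hy := phi_inv_gt0 y0.
by rewrite phi_inv_le// (le_trans xy)// -phi_inv_le.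
Qed.

Lemma phi_inv_contract (a x : R) : 0 < a <= 1 -> 0 < x ->
  phi_inv G (a `^ q * x) <= a * phi_inv G x.
Proof.
move=> a01 x0; have a0 : 0 < a by case/andP: a01.
have Hx := phi_inv_gt0 x0.
rewrite phi_inv_le ?mulr_gt0 ?powR_gt0//.
apply: (le_trans _ (power_growth_contract_ge (ltW Hx) a01)).
by rewrite ler_pM2l ?powR_gt0// -phi_inv_le.
Qed.

Lemma phi_inv_dilate (a x : R) : 1 <= a -> 0 < x ->
  phi_inv G (a `^ p * x) <= a * phi_inv G x.
Proof.
move=> a1 x0; have a0 := lt_le_trans ltr01 a1; have Hx := phi_inv_gt0 x0.
rewrite phi_inv_le ?mulr_gt0 ?powR_gt0//.
apply: (le_trans _ (G_low (ltW Hx) a1)).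
by rewrite ler_pM2l ?powR_gt0// -phi_inv_le.
Qed.

End PowerGrowth.

(** * The modular of the Orlicz-Lorentz norm and upper bounds for dilations *)

Definition OL_modular {R : realType} (G : R -> R) (f : R -> R) (c : R) : \bar R :=
  (\int[(@lebesgue_measure R)]_(x in `]0%R, +oo[)
     ext_phi G (dec_rearr f (phi_inv (tilde G) x) * (c^-1)%:E))%E.

Section OrliczLorentzNorm.
Context {R : realType}.
Local Open Scope classical_set_scope.
Local Notation mu := (@lebesgue_measure R).
Variables (p q : R) (G : R -> R).
Hypotheses (p0 : 0 < p) (q0 : 0 < q) (GP : power_growth p q G).
Local Notation H := (phi_inv (tilde G)).
Local Notation integrand f c :=
  (fun x => ext_phi G (dec_rearr f (H x) * (c^-1)%:E)%E).

Let TP : power_growth p q (tilde G). Proof. exact: power_growth_tilde. Qed.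

Lemma ext_phi_ge0 (e : \bar R) : (0 <= e -> 0 <= ext_phi G e)%E.
Proof. by case: e => [r| |]//=; rewrite !lee_fin; exact: (power_growth_ge0 GP). Qed.

Lemma ext_phi_le (e1 e2 : \bar R) :
  (0 <= e1 -> e1 <= e2 -> ext_phi G e1 <= ext_phi G e2)%E.
Proof.
case: e1 => [r| |]//; case: e2 => [s| |]//=; rewrite ?leey// !lee_fin => r0 rs.
exact: (power_growth_le p0 GP).
Qed.

Lemma integrand_ge0 (f : R -> R) (c x : R) : 0 < c -> (0 <= integrand f c x)%E.
Proof.
move=> c0; apply/ext_phi_ge0/mule_ge0; first exact: dec_rearr_ge0.
by rewrite lee_fin invr_ge0 ltW.
Qed.

Lemma integrand_anti (f : R -> R) (c x y : R) : 0 < c -> 0 < x -> x <= y ->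
  (integrand f c y <= integrand f c x)%E.
Proof.
move=> c0 x0 xy; have ci0 : (0 <= (c^-1)%:E)%E by rewrite lee_fin invr_ge0 ltW.
apply: ext_phi_le; first by rewrite mule_ge0// dec_rearr_ge0.
by rewrite lee_wpmul2r// dec_rearr_anti// (phi_inv_homo p0 q0 TP).
Qed.

Lemma measurable_integrand (f : R -> R) (c : R) : 0 < c ->
  measurable_fun (`]0, +oo[ : set R) (integrand f c).
Proof. by move=> c0; apply: nonincreasing_emeasurable => x y; exact: integrand_anti. Qed.

Lemma measurable_integrand_mulr (f : R -> R) (c b : R) : 0 < c -> 0 < b ->
  measurable_fun (`]0, +oo[ : set R) (fun x => integrand f c (b * x)).
Proof.
move=> c0 b0; apply: nonincreasing_emeasurable => x y x0 xy.
by apply: integrand_anti; rewrite ?mulr_gt0 ?ler_pM2l.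
Qed.

(** [tilde] of the identity is the identity, and the endpoint 0 is a null set. Dropping it leaves
    positive arguments only, where the inverse is known to be monotone. *)
Lemma L1G_normE (f : R -> R) : L1G_norm G f =
  ereal_inf [set c%:E | c in [set c | 0 < c /\ (OL_modular G f c <= 1)%E]].
Proof.
congr (ereal_inf (EFin @` _)); apply/funext => c /=.
rewrite propeqE; split => -[c0].
all: suff -> : OL_modular G f c = (\int[mu]_(x in @halfline R) ext_phi G
  (`|dec_rearr f (tilde id (H x))| * (c^-1)%:E))%E by [].
all: rewrite /OL_modular integral_itv_obnd_cbnd; last exact: measurable_integrand.
all: apply: eq_integral => x _.
all: rewrite gee0_abs ?dec_rearr_ge0// /tilde; case: eqP => [->//|_].
all: by rewrite invrK.
Qed.

(** The rearrangement of [dilation a f] at [H x] is that of [f] at [a * H x], hence at most that of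
    [f] at [H (b * x)]. Dividing by [K] costs at most a factor [b] in [G], which cancels the [b^-1]
    from substituting [b * x]. *)
Lemma OL_modular_dilation (a b c K : R) (f : R -> R) :
  measurable_fun (@halfline R) f -> 0 < a -> 0 < b -> 0 < c -> 0 < K ->
  (forall x : R, 0 < x -> H (b * x) <= a * H x) ->
  (forall y : R, 0 <= y -> G (y / K) <= b * G y) ->
  (OL_modular G (dilation a f) (K * c) <= OL_modular G f c)%E.
Proof.
move=> mf a0 b0 c0 K0 Hb Gb.
have Kc0 : 0 < K * c by rewrite mulr_gt0.
apply: (@le_trans _ _
  (\int[mu]_(x in `]0%R, +oo[) (b%:E * integrand f c (b * x)%R))%E).
  apply: ge0_le_integral => //=.
  - by move=> x _; exact: integrand_ge0.
  - exact: measurable_integrand.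
  - by apply: measurable_funeM; exact: (measurable_integrand_mulr f c0 b0).
  - move=> x; rewrite in_itv /= andbT => x0.
    rewrite dec_rearr_dilation//.
    apply: (@le_trans _ _ (integrand f (K * c) (b * x))).
      apply: ext_phi_le.
        by rewrite mule_ge0// ?dec_rearr_ge0// lee_fin invr_ge0 ltW.
      by rewrite lee_wpmul2r ?lee_fin ?invr_ge0 ?(ltW Kc0)// dec_rearr_anti// Hb.
    rewrite invfM [(K^-1 * _)%R]mulrC EFinM muleA.
    set e := (dec_rearr _ _ * _)%E.
    have : (0 <= e)%E.
      by rewrite mule_ge0// ?dec_rearr_ge0// lee_fin invr_ge0 ltW.
    case: e => [r|_|]//; first by rewrite !lee_fin; exact: Gb.
    by rewrite [X in (_ <= _ * X)%E]/= gt0_muley ?lte_fin// leey.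
rewrite ge0_integralZl//=; [| | |exact: ltW].
- rewrite (@ge0_integral_mulr R b (integrand f c))//.
  + by rewrite muleA -EFinM mulfV ?gt_eqF// mul1e.
  + exact: measurable_integrand.
  + by move=> x _; exact: integrand_ge0.
- exact: (measurable_integrand_mulr f c0 b0).
- by move=> x _; exact: integrand_ge0.
Qed.

Lemma L1G_norm_dilation (a b K : R) (f : R -> R) :
  measurable_fun (@halfline R) f -> 0 < a -> 0 < b -> 0 < K ->
  (forall x : R, 0 < x -> H (b * x) <= a * H x) ->
  (forall y : R, 0 <= y -> G (y / K) <= b * G y) ->
  (L1G_norm G (dilation a f) <= K%:E * L1G_norm G f)%E.
Proof.
move=> mf a0 b0 K0 Hb Gb; rewrite !L1G_normE -lee_pdivrMl//.
apply: le_ereal_inf_tmp => _ [c [c0 mc] <-]; rewrite lee_pdivrMl// -EFinM.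
apply: ereal_inf_lbound; exists (K * c) => //=; split; first exact: mulr_gt0.
exact: le_trans (OL_modular_dilation mf a0 b0 c0 K0 Hb Gb) mc.
Qed.

(** The value of [K] balancing the two effects: [K ^ (- p) = a ^ q] with [b = a ^ q] when [a <= 1],
    and [K ^ (- q) = a ^ p] with [b = a ^ p] when [a > 1]. *)
Definition dil_bound (a : R) : R :=
  if a <= 1 then a `^ (- (q / p)) else a `^ (- (p / q)).

Lemma dil_bound_gt0 (a : R) : 0 < a -> 0 < dil_bound a.
Proof. by move=> a0; rewrite /dil_bound; case: ifP => _; exact: powR_gt0. Qed.

Lemma L1G_norm_dilation_le (a : R) (f : R -> R) : 0 < a ->
  measurable_fun (@halfline R) f ->
  (L1G_norm G (dilation a f) <= (dil_bound a)%:E * L1G_norm G f)%E.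
Proof.
move=> a0 mf; have K0 := dil_bound_gt0 a0.
move: K0; rewrite /dil_bound; have [a1|/ltW a1] := leP a 1 => K0.
- apply: (@L1G_norm_dilation a (a `^ q)) => // [|x x0|y y0].
  + exact: powR_gt0.
  + by apply: (phi_inv_contract p0 q0 TP) => //; rewrite a0.
  + rewrite powRN invrK mulrC.
    apply: (le_trans (power_growth_contract GP y0 _)).
      by rewrite powR_gt0//= -(powRr0 a) ger_powR ?a0// divr_ge0 ?ltW.
    by rewrite -powRrM divfK ?gt_eqF.
- apply: (@L1G_norm_dilation a (a `^ p)) => // [|x x0|y y0].
  + exact: powR_gt0.
  + exact: (phi_inv_dilate p0 q0 TP).
  + rewrite powRN invrK mulrC; case: (GP) => _ _ _ up.
    apply: (le_trans (up y _ y0 _)).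
      by rewrite -(powRr0 a) ler_powR// divr_ge0 ?ltW.
    by rewrite -powRrM divfK ?gt_eqF.
Qed.

Lemma dil_norm_le (a : R) : 0 < a ->
  (dil_norm (L1G_norm G) a <= (dil_bound a)%:E)%E.
Proof.
move=> a0; apply/ereal_supP => _ [f /= [mf [N0 Noo]] <-].
have Nfin : L1G_norm G f \is a fin_num by rewrite ge0_fin_numE// ltW.
have N0' : 0 < fine (L1G_norm G f) by rewrite -lte_fin fineK.
by rewrite muleC lee_pdivrMl// fineK// muleC L1G_norm_dilation_le.
Qed.

End OrliczLorentzNorm.

(** * Sums of indicators and maxima of steps *)

Section StepFunctions.
Context {R : realType}.
Local Open Scope classical_set_scope.
Local Notation mu := (@lebesgue_measure R).

Lemma integral_sum_indic (N : nat) (g X : nat -> R) :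
  (forall k, 0 <= g k) -> (forall k, 0 < X k) ->
  (\int[mu]_(x in `]0%R, +oo[) (\sum_(k < N) g k * \1_(`]0, X k]) x)%:E =
   (\sum_(k < N) g k * X k)%:E)%E.
Proof.
move=> g0 X0; under eq_integral do rewrite -sumEFin.
rewrite ge0_integral_sum//=; last 2 first.
- move=> k; apply/measurable_EFinP; apply: measurable_funM => //.
- by move=> k x _; rewrite lee_fin mulr_ge0.
rewrite -sumEFin; apply: eq_bigr => k _.
under eq_integral do rewrite EFinM.
rewrite ge0_integralZl//=; last 2 first.
- by apply/measurable_EFinP; exact: measurable_indic.
- by rewrite lee_fin.
rewrite integral_indic// EFinM; congr (_ * _)%E.
rewrite setIidl /=; last by apply: subset_itvl; rewrite bnd_simp.
by rewrite lebesgue_measure_itv/= lte_fin X0 sube0.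
Qed.

Lemma measurable_sum_indic (N : nat) (g X : nat -> R) (D : set R) :
  measurable_fun D (fun x : R => (\sum_(k < N) g k * \1_(`]0, X k]) x)%:E).
Proof.
apply/measurable_EFinP; apply: measurable_sum => k.
by apply: measurable_funM => //; exact: measurable_indic.
Qed.

Lemma indic_itv_gt0 (X x : R) : 0 < x -> \1_(`]0, X]) x = (x <= X)%R%:R :> R.
Proof. by move=> x0; rewrite indicE mem_setE in_itv/= x0. Qed.

(** Each term is at least the sum of all earlier ones, so the last selected term carries half of the
    selected sum; [m = 0] covers an empty selection. *)
Lemma sum_geometric_le (g : nat -> R) (b : nat -> bool) (n : nat) :
  (forall k, 0 <= g k) -> (forall k, 2 * g k <= g k.+1) ->
  exists2 m, m = 0 \/ exists2 k, (k < n)%N /\ b k & m = g k &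
    \sum_(k < n) g k * (b k)%:R <= 2 * m.
Proof.
move=> g0 g2.
have sum_le k : \sum_(j < k) g j <= g k.
  elim: k => [|k IH]; first by rewrite big_ord0.
  by rewrite big_ord_recr/=; apply: le_trans (g2 k); lra.
elim: n => [|n [m mE IH]]; first by exists 0; [left|rewrite big_ord0 mulr0].
rewrite big_ord_recr /=; case: (boolP (b n)) => bn.
  exists (g n); first by right; exists n.
  rewrite mulr1; suff : \sum_(i < n) g i * (b i)%:R <= g n by lra.
  apply: le_trans (sum_le n); apply: ler_sum => i _.
  by case: (b i); rewrite ?mulr1// mulr0.
exists m; last by rewrite mulr0 addr0.
case: mE => [->|[k [kn bk] ->]]; [by left|right].
by exists k => //; split => //; exact: ltnW.
Qed.

(** The maximum of the [y k] times the indicator of [[0, 1 / x k]]. With positive [x k], the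
    condition [s * x k <= 1] makes it nonincreasing on the whole line, hence measurable. *)
Definition step_max (N : nat) (x y : nat -> R) (s : R) : R :=
  \big[Num.max/0]_(k < N) (if s * x k <= 1 then y k else 0).

Variables (N : nat) (x y : nat -> R).
Hypotheses (x_gt0 : forall k, 0 < x k) (y_gt0 : forall k, 0 < y k).
Local Notation f := (step_max N x y).

Lemma step_max_ge0 (s : R) : 0 <= f s.
Proof. exact: bigmax_ge_id. Qed.

Lemma step_max_ge (k : nat) (s : R) : (k < N)%N -> s * x k <= 1 -> y k <= f s.
Proof.
move=> kN sx; rewrite /step_max.
have := le_bigmax 0 (fun k : 'I_N => if s * x k <= 1 then y k else 0) (Ordinal kN).
by rewrite /= sx.
Qed.

Lemma step_max_le (s M : R) : 0 <= M ->
  (forall k, (k < N)%N -> s * x k <= 1 -> y k <= M) -> f s <= M.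
Proof.
move=> M0 h; apply: bigmax_le => // k _; case: ifP => // sx; exact: h.
Qed.

Lemma measurable_step_max (D : set R) : measurable D -> measurable_fun D f.
Proof.
move=> mD; apply: nonincreasing_measurable => // s t st.
apply: step_max_le => [|k kN tx]; first exact: step_max_ge0.
by apply: step_max_ge => //; apply: le_trans tx; rewrite ler_pM2r.
Qed.

End StepFunctions.

Lemma le_div_fine {R : realType} (D : R) (m n : \bar R) : 0 <= D ->
  (0 < n -> n <= 1 -> D%:E <= m -> D%:E <= m * ((fine n)^-1)%:E)%E.
Proof.
case: n => [n| |]// D0; rewrite lte_fin lee_fin /= => n0 n1 Dm.
rewrite muleC lee_pdivlMl//; apply: le_trans Dm.
by rewrite -EFinM lee_fin ler_piMl.
Qed.

(** * Lower bounds for dilation norms from step functions *)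

Section TestFunctions.
Context {R : realType}.
Local Open Scope classical_set_scope.
Local Notation mu := (@lebesgue_measure R).
Variables (p q : R) (G : R -> R).
Hypotheses (p0 : 0 < p) (q0 : 0 < q) (GP : power_growth p q G).
Local Notation H := (phi_inv (tilde G)).
Variables (N : nat) (x y : nat -> R).
Hypotheses (x_gt0 : forall k, 0 < x k) (y_gt0 : forall k, 0 < y k).
Local Notation f := (step_max N x y).

Let TP : power_growth p q (tilde G). Proof. exact: power_growth_tilde. Qed.
Let Gx k : 0 < G (x k). Proof. by case: GP => _ + _ _; apply. Qed.
Let mf : measurable_fun (@halfline R) f.
Proof. by apply: measurable_step_max => //; exact: measurable_itv. Qed.

(** Moves a jump of the test function at [1 / s] to [1 / G s] in the variable of integration. *)
Lemma phi_inv_tilde_le (r s : R) : 0 < r -> 0 < s ->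
  (H r <= s^-1) = (r <= (G s)^-1).
Proof.
by move=> r0 s0; rewrite (phi_inv_le p0 q0 TP) ?invr_gt0// tildeE ?invr_gt0// invrK.
Qed.

Lemma dec_rearr_step_max_le (r : R) : 0 < r ->
  (dec_rearr f (H r) <=
   (\big[Num.max/0]_(k < N) (if r <= (G (x k))^-1 then y k else 0))%:E)%E.
Proof.
move=> r0; set M := \big[_/_]_(k < N) _.
have M0 : 0 <= M by exact: bigmax_ge_id.
(* The last jump strictly to the left of [H r], or 0 if there is none; beyond it only steps with
   [r <= 1 / G (x k)] survive. *)
pose r' := \big[Num.max/0]_(k < N) (if r <= (G (x k))^-1 then 0 else (x k)^-1).
apply: (@dec_rearr_le _ _ _ _ r') => //.
- exact: bigmax_ge_id.
- apply: bigmax_lt => [|k _]; first exact: (phi_inv_gt0 p0 TP).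
  case: ifPn => [_|]; first exact: (phi_inv_gt0 p0 TP).
  by rewrite -phi_inv_tilde_le// -ltNge.
- move=> s r's; rewrite ger0_norm ?step_max_ge0//.
  apply: step_max_le => // k kN sx.
  have := le_bigmax 0 (fun k : 'I_N => if r <= (G (x k))^-1 then 0 else (x k)^-1)
    (Ordinal kN).
  have := le_bigmax 0 (fun k : 'I_N => if r <= (G (x k))^-1 then y k else 0)
    (Ordinal kN).
  rewrite -/M -/r' /=; case: ifP => // _ _ /le_lt_trans/(_ r's).
  by rewrite -(ltr_pM2r (x_gt0 k)) mulVf ?gt_eqF// ltNge sx.
Qed.

Lemma OL_modular_step_max_le :
  (OL_modular G f 1 <= (\sum_(k < N) G (y k) / G (x k))%:E)%E.
Proof.
have Gy k : 0 <= G (y k) by apply: (power_growth_ge0 GP); exact: ltW.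
rewrite -(integral_sum_indic N (g := G \o y) (X := fun k => (G (x k))^-1))//;
  last by move=> k; rewrite invr_gt0.
apply: ge0_le_integral => //=.
- by move=> r _; exact: (integrand_ge0 GP).
- exact: (measurable_integrand p0 q0 GP).
- exact: (measurable_sum_indic N (G \o y) (fun k => (G (x k))^-1)).
- move=> r; rewrite in_itv/= andbT => r0.
  rewrite invr1 mule1.
  apply: (le_trans (ext_phi_le p0 GP (dec_rearr_ge0 _ _) (dec_rearr_step_max_le r0))).
  rewrite /= lee_fin; set M := \big[_/_]_(k < N) _; set S := \sum_(k < N) _.
  suff : 0 <= M /\ G M <= S by case.
  apply: (big_ind2 (fun m s => 0 <= m /\ G m <= s)).
  + by case: GP => ->.
  + move=> m1 s1 m2 s2 [m10 Gm1] [m20 Gm2]; rewrite le_max m10; split => //.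
    have := le_trans (power_growth_ge0 GP m10) Gm1.
    have := le_trans (power_growth_ge0 GP m20) Gm2.
    by case: (leP m1 m2) => _; lra.
  + move=> k _; rewrite indic_itv_gt0//.
    by case: ifP => _; rewrite ?mulr1 ?mulr0; split => //; [exact: ltW|case: GP => ->].
Qed.

(** At each [r] the steps still present have a sum at most twice a single one of them, by geometric
    growth, and the rearrangement is at least the height of that step. *)
Lemma OL_modular_step_max_ge (a c D : R) : 0 < a -> 0 < c -> c <= D ->
  (forall k, 2 * G (y k / D) <= G (y k.+1 / D)) ->
  ((2^-1 * \sum_(k < N) G (y k / D) / G (a * x k))%:E <=
    OL_modular G (dilation a f) c)%E.
Proof.
move=> a0 c0 cD Gy2; have D0 := lt_le_trans c0 cD.
have Gy k : 0 <= G (y k / D).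
  by apply: (power_growth_ge0 GP); rewrite ltW// divr_gt0.
have Gax k : 0 < G (a * x k) by case: GP => _ + _ _; apply; exact: mulr_gt0.
rewrite EFinM -(integral_sum_indic N (g := fun k => G (y k / D))
  (X := fun k => (G (a * x k))^-1))//; last by move=> k; rewrite invr_gt0.
rewrite -ge0_integralZl//=; last 2 first.
- exact: (measurable_sum_indic N (fun k => G (y k / D)) (fun k => (G (a * x k))^-1)).
- by move=> r _; rewrite lee_fin sumr_ge0// => k _; rewrite mulr_ge0.
apply: ge0_le_integral => //=.
- move=> r _; rewrite lee_fin mulr_ge0// ?invr_ge0// sumr_ge0// => k _.
  by rewrite mulr_ge0.
- apply: measurable_funeM.
  exact: (measurable_sum_indic N (fun k => G (y k / D)) (fun k => (G (a * x k))^-1)).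
- exact: (measurable_integrand p0 q0 GP).
move=> r; rewrite in_itv/= andbT => r0.
have [m mE mge] := sum_geometric_le (fun k => r <= (G (a * x k))^-1) N Gy Gy2.
apply: (@le_trans _ _ m%:E).
  rewrite -EFinM lee_fin ler_pdivrMl//; apply: le_trans mge.
  by apply: ler_sum => k _; rewrite indic_itv_gt0.
case: mE => [->|[k [kN rk] ->]]; first exact: (integrand_ge0 GP).
have yc : 0 <= y k / c by rewrite ltW// divr_gt0.
apply: (@le_trans _ _ (ext_phi G (y k / c)%:E)).
  rewrite lee_fin; apply: (power_growth_le p0 GP); first by rewrite ltW// divr_gt0.
  by rewrite ler_pM2l// lef_pV2.
apply: (ext_phi_le p0 GP); first by rewrite lee_fin.
rewrite EFinM lee_wpmul2r ?lee_fin ?invr_ge0 ?(ltW c0)// dec_rearr_dilation//.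
apply: (@dec_rearr_ge _ _ _ _ (x k)^-1) => // [|s /andP[s0 sx]].
  rewrite -(ler_pM2l (_ : 0 < a^-1)) ?invr_gt0// mulKf ?gt_eqF// -invfM.
  by rewrite phi_inv_tilde_le ?mulr_gt0.
rewrite ger0_norm ?step_max_ge0// step_max_ge//.
by rewrite -ler_pdivlMr// mul1r.
Qed.

(** The second growth hypothesis gives [f] modular at most [N * (1 / N) = 1], so norm at most 1. The
    third gives [dilation a f] modular at least [(N * 4 / N) / 2 = 2] at every [c <= D], so norm at
    least [D]. *)
Lemma dil_norm_ge (a D : R) : 0 < a -> 0 < D -> (0 < N)%N ->
  (forall k, 2 * G (y k / D) <= G (y k.+1 / D)) ->
  (forall k, G (y k) * N%:R <= G (x k)) ->
  (forall k, 4 * G (a * x k) <= G (y k / D) * N%:R) ->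
  (D%:E <= dil_norm (L1G_norm G) a)%E.
Proof.
move=> a0 D0 N0 Gy2 Gyx Gax.
have NR : (0 : R) < N%:R by rewrite ltr0n.
have Gax0 k : 0 < G (a * x k) by case: GP => _ + _ _; apply; exact: mulr_gt0.
have Nf1 : (L1G_norm G f <= 1)%E.
  rewrite (L1G_normE p0 q0 GP); apply: ereal_inf_lbound; exists 1 => //=; split => //.
  apply: (le_trans OL_modular_step_max_le); rewrite lee_fin.
  apply: (@le_trans _ _ (\sum_(k < N) N%:R^-1)).
    by apply: ler_sum => k _; rewrite ler_pdivrMr// ler_pdivlMl// mulrC.
  by rewrite sumr_const card_ord -[leLHS]mulr_natr mulVf ?gt_eqF.
have NdD : (D%:E <= L1G_norm G (dilation a f))%E.
  rewrite (L1G_normE p0 q0 GP); apply: le_ereal_inf_tmp => _ [c [c0 mc] <-].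
  rewrite lee_fin leNgt; apply/negP => /ltW cD; move: mc; apply/negP; rewrite -ltNge.
  apply: lt_le_trans (OL_modular_step_max_ge a0 c0 cD Gy2); rewrite lte_fin.
  apply: (@lt_le_trans _ _ (2^-1 * \sum_(k < N) 4 / N%:R)).
    rewrite sumr_const card_ord -[X in _ < _ * X]mulr_natr divfK ?gt_eqF//; lra.
  rewrite ler_pM2l ?invr_gt0//; apply: ler_sum => k _.
  by rewrite ler_pdivrMr// mulrAC ler_pdivlMr.
(* If this norm were zero, the upper dilation bound would make the norm of [dilation a f] zero as
   well, contradicting [NdD]. *)
have Nf0 : (0 < L1G_norm G f)%E.
  have K0 := dil_bound_gt0 p q a0.
  have := le_trans NdD (L1G_norm_dilation_le p0 q0 GP a0 mf).
  rewrite -(lee_pdivrMl _ _ K0); apply: lt_le_trans.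
  by rewrite -EFinM lte_fin; apply: mulr_gt0 => //; rewrite invr_gt0.
have Nfoo := le_lt_trans Nf1 (ltry 1).
apply: (le_trans (le_div_fine (ltW D0) Nf0 Nf1 NdD)).
by apply: ereal_sup_ubound; exists f.
Qed.

End TestFunctions.

(** * The function with alternating logarithmic slopes *)

Section Construction.
Context {R : realType}.
Local Open Scope classical_set_scope.
Local Notation mu := (@lebesgue_measure R).

(** The values of [ln t] at which the slope is to be [q]; these intervals and the gaps between them
    grow without bound. *)
Definition blocks : set R := \bigcup_k `]2 * 4 ^+ k, 4 ^+ k.+1[.

(** The primitive of the indicator of [blocks], taken as a measure so that its increments are
    measures too. *)
Definition block_measure (v : R) : R := fine (mu (blocks `&` `[0, v])).

Lemma measurable_blocks : measurable blocks.
Proof. by apply: bigcup_measurable => k _; exact: measurable_itv. Qed.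

Let mblocks_itv (i : interval R) : measurable (blocks `&` [set` i]).
Proof. by apply: measurableI; [exact: measurable_blocks|exact: measurable_itv]. Qed.

Lemma measure_blocks_le (v w : R) : v <= w ->
  (mu (blocks `&` `]v, w]) <= (w - v)%:E)%E.
Proof.
move=> vw; apply: (@le_trans _ _ (mu `]v, w])).
  by apply: le_measure; rewrite ?inE//; exact: mblocks_itv.
rewrite lebesgue_measure_itv/= lte_fin; case: ifP => _; first by rewrite EFinB.
by rewrite lee_fin subr_ge0.
Qed.

Let blocks_gt0 (z : R) : blocks z -> 0 < z.
Proof.
move=> [k _] /=; rewrite in_itv/= => /andP[+ _]; apply: le_lt_trans.
by rewrite mulr_ge0// exprn_ge0.
Qed.

(** Negative [v] are allowed because the blocks lie in the positive half-line. *)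
Lemma block_measureB (v w : R) : v <= w ->
  (block_measure w - block_measure v)%:E = mu (blocks `&` `]v, w]).
Proof.
move=> vw; have fin u : mu (blocks `&` `[0, u]) \is a fin_num.
  rewrite ge0_fin_numE ?measure_ge0//; apply: (@le_lt_trans _ _ (mu `[0, u])).
    by apply: le_measure; rewrite ?inE//; exact: mblocks_itv.
  by rewrite lebesgue_measure_itv/=; case: ifP => _; rewrite ltry.
rewrite EFinB !fineK//.
have -> : blocks `&` `[0, w] = (blocks `&` `[0, v]) `|` (blocks `&` `]v, w]).
  apply/seteqP; split => z /=; rewrite !in_itv/=.
    by case=> Bz /andP[z0 zw]; rewrite z0 zw andbT /=; case: (leP z v) => _; [left|right].
  case=> -[Bz /andP[z1 z2]]; split => //; first by rewrite z1 (le_trans z2).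
  by rewrite ltW// blocks_gt0.
rewrite measureU//; first by rewrite /= addeAC subee// add0e.
- exact: mblocks_itv.
- exact: mblocks_itv.
- rewrite -subset0 => z /=; rewrite !in_itv/= => -[[_ /andP[_ zv]] [_ /andP[vz _]]].
  by move: vz; rewrite ltNge zv.
Qed.

Lemma block_measure_lip (v w : R) : v <= w ->
  0 <= block_measure w - block_measure v <= w - v.
Proof.
move=> vw; rewrite -!lee_fin block_measureB// measure_ge0 measure_blocks_le//.
Qed.

Lemma block_measure_flat (k : nat) (v w : R) : 4 ^+ k <= v -> v <= w ->
  w <= 2 * 4 ^+ k -> block_measure w - block_measure v = 0.
Proof.
move=> kv vw wk; apply/EFin_inj; rewrite block_measureB//.
rewrite (_ : _ `&` _ = set0) ?measure0//.
rewrite -subset0 => z [[j _] /=]; rewrite !in_itv/= => /andP[jz zj] /andP[vz zw].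
(* A block [j] meeting the interval would need both [k <= j] and [4 ^ j < 4 ^ k]. *)
have : 4 ^+ k < 4 ^+ j.+1 :> R by lra.
rewrite ltr_eXn2l ?ltr1n// ltnS => kj.
have : 4 ^+ k <= 4 ^+ j :> R by rewrite ler_eXn2l ?ltr1n.
by lra.
Qed.

Lemma block_measure_rise (k : nat) (v w : R) : 2 * 4 ^+ k <= v -> v <= w ->
  w <= 4 ^+ k.+1 -> block_measure w - block_measure v = w - v.
Proof.
move=> kv vw wk; apply/eqP; rewrite eq_le; case/andP: (block_measure_lip vw) => _ -> /=.
rewrite -lee_fin block_measureB//; apply: (@le_trans _ _ (mu `]v, w[)).
  rewrite lebesgue_measure_itv/= lte_fin; case: ltP => // wv.
  by rewrite lee_fin subr_le0.
apply: le_measure; rewrite ?inE//; first exact: mblocks_itv.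
move=> z /=; rewrite !in_itv/= => /andP[vz zw]; split; last by rewrite vz ltW.
by exists k => //=; rewrite in_itv/=; apply/andP; split; lra.
Qed.

Variables (p q : R).
Hypothesis pq : p < q.

(* [ln (block_phi (expR v))] is piecewise linear in [v], with slope [p] on each
   [[4^k, 2 * 4^k]] and slope [q] on each [[2 * 4^k, 4^(k+1)]]. *)
Definition block_phi (t : R) : R :=
  if 0 < t then expR (p * ln t + (q - p) * block_measure (ln t)) else 0.
Local Notation G := block_phi.

Lemma block_phi_gt0 (t : R) : 0 < t -> 0 < G t.
Proof. by move=> t0; rewrite /block_phi t0 expR_gt0. Qed.

Lemma block_phiM (t a : R) : 0 < t -> 0 < a ->
  G (a * t) = a `^ p *
    expR ((q - p) * (block_measure (ln t + ln a) - block_measure (ln t))) * G t.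
Proof.
move=> t0 a0; rewrite /block_phi mulr_gt0// t0 /powR gt_eqF// -!expRD.
by rewrite lnM ?posrE// [ln a + _]addrC; congr expR; ring.
Qed.

(** From [ln t] to [ln t + ln a] the block measure gains between 0 and [ln a], so the exponent of
    [a] gained lies between [p] and [q]. *)
Lemma power_growth_block_phi : power_growth p q G.
Proof.
split; [by rewrite /block_phi ltxx|exact: block_phi_gt0| |].
all: move=> t a; rewrite le_eqVlt => /predU1P[<-|t0] a1;
  first by rewrite mulr0 /block_phi ltxx mulr0.
all: have a0 := lt_le_trans ltr01 a1; rewrite block_phiM// ler_pM2r ?block_phi_gt0//.
all: have lna : ln t <= ln t + ln a by rewrite lerDl ln_ge0.
all: have /andP[d0] := block_measure_lip lna; rewrite addrAC subrr add0r => d1.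
- rewrite ler_pMr ?powR_gt0// -expR0 ler_expR mulr_ge0// subr_ge0 ltW//.
- rewrite /powR gt_eqF// -expRD ler_expR.
  suff : (q - p) * (block_measure (ln t + ln a) - block_measure (ln t))
    <= (q - p) * ln a by lra.
  by rewrite ler_pM2l ?subr_gt0.
Qed.

Lemma block_phi_flat (k : nat) (t a : R) : 0 < t -> 1 <= a ->
  4 ^+ k <= ln t -> ln t + ln a <= 2 * 4 ^+ k -> G (a * t) = a `^ p * G t.
Proof.
move=> t0 a1 kt ak; have a0 := lt_le_trans ltr01 a1.
rewrite block_phiM// (block_measure_flat kt) ?mulr0 ?expR0 ?mulr1//.
by rewrite lerDl ln_ge0.
Qed.

Lemma block_phi_rise (k : nat) (t a : R) : 0 < t -> 1 <= a ->
  2 * 4 ^+ k <= ln t -> ln t + ln a <= 4 ^+ k.+1 -> G (a * t) = a `^ q * G t.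
Proof.
move=> t0 a1 kt ak; have a0 := lt_le_trans ltr01 a1.
rewrite block_phiM// (block_measure_rise kt)//; last by rewrite lerDl ln_ge0.
by rewrite /powR gt_eqF// -expRD; congr (expR _ * _); ring.
Qed.

End Construction.

(** * Power growth implies the phi-function axioms *)

Section PhiFunction.
Context {R : realType}.
Local Open Scope classical_set_scope.
Variables (p q : R) (G : R -> R).
Hypotheses (p0 : 0 < p) (q0 : 0 < q) (GP : power_growth p q G).

Lemma power_growth_continuous (t : R) : 0 < t -> {for t, continuous G}.
Proof.
move=> t0; have Gt : 0 < G t by case: GP => _ + _ _; apply.
apply/cvgrPdist_le => e e0.
(* With [a ^ q = r], moving the argument by a factor at most [a] changes [G] by a factor at most
   [r], and [r * G t = G t + e]. *)
pose r := 1 + e / G t.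
have r1 : 1 < r by rewrite /r ltrDl divr_gt0.
have r0 := lt_trans ltr01 r1.
pose a := r `^ q^-1.
have a1 : 1 < a by rewrite powR_gt1// invr_gt0.
have a0 := lt_trans ltr01 a1.
have aq : a `^ q = r by rewrite powRVK ?gt_eqF// ltW.
have ge : r * G t = G t + e by rewrite /r mulrDl mul1r divfK ?gt_eqF.
near=> s.
have s0 : 0 < s by near: s; exact: lt_nbhsr.
have sa : s <= a * t.
  by apply: ltW; near: s; apply: lt_nbhsl; rewrite ltr_pMl.
have tas : a^-1 * t <= s.
  by apply: ltW; near: s; apply: lt_nbhsr; rewrite ltr_pdivrMl// ltr_pMl.
have Gs1 : G s <= G t + e.
  apply: (le_trans (power_growth_le p0 GP (ltW s0) sa)).
  by case: GP => _ _ _ /(_ t a (ltW t0) (ltW a1)); rewrite aq ge.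
have Gs2 : G t <= r * G s.
  rewrite -aq; case: (GP) => _ _ _ /(_ s a (ltW s0) (ltW a1)); apply: le_trans.
  by apply: (power_growth_le p0 GP (ltW t0)); rewrite -ler_pdivrMl.
rewrite ler_norml; apply/andP; split; first by lra.
have [|Gst] := leP (G t) (G s); first by lra.
have : r * G s = G s + e / G t * G s by rewrite /r; ring.
have : e / G t * G s <= e.
  by rewrite -mulrA ler_piMr ?ltW// mulrC ltr_pdivrMr// mul1r.
by lra.
Unshelve. all: by end_near. Qed.

Lemma power_growth_phi_function : phi_function G.
Proof.
have [G0 G_gt0 _ _] := GP; split => //.
- apply/continuous_within_itvcyP; split => [t|].
    rewrite in_itv/= andbT; exact: power_growth_continuous.
  rewrite G0; apply/cvgrPdist_le => e e0.
  have [s s0 Gs] := power_growth_surj_le p0 GP e0.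
  near=> t; have t0 : 0 < t by [].
  rewrite sub0r normrN ger0_norm ?(ltW (G_gt0 _ t0))//; apply: le_trans Gs.
  by apply: (power_growth_le p0 GP (ltW t0)); near: t; exact: nbhs_right_le.
- move=> s t; exact: (power_growth_lt p0 GP).
- apply/cvgryPge => A; have [s s0 As] := power_growth_surj_ge p0 GP A.
  near=> t; apply: (le_trans As); apply: (power_growth_le p0 GP (ltW s0)).
  by near: t; apply: nbhs_pinfty_ge; exact: num_real.
Unshelve. all: by end_near. Qed.

End PhiFunction.

(** * Comparing exponents and rounding *)

Section Asymptotics.
Context {R : realType}.

Lemma powR_le_asymptotic (c C r s a0 : R) : 0 < c ->
  (forall a, a0 < a -> 1 < a -> c * a `^ r <= C * a `^ s) -> r <= s.
Proof.
move=> c0 h; rewrite leNgt; apply/negP => sr.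
have sr0 : 0 < r - s by rewrite subr_gt0.
have B0 : 0 <= `|C| / c + 1 by rewrite addr_ge0// divr_ge0// ltW.
(* Solves [c * b ^ (r - s) = |C| + c], which exceeds [C]; the witness [a] below is larger than [b],
   [a0] and 1. *)
set b := (`|C| / c + 1) `^ (r - s)^-1.
have b0 : 0 <= b by exact: powR_ge0.
have m0 := normr_ge0 a0; have m1 := ler_norm a0.
pose a := `|a0| + 2 + b.
have a1 : 1 < a by rewrite /a; lra.
have ap : 0 < a by lra.
have := h a; apply/not_implyP; split; first by rewrite /a; lra.
apply/not_implyP; split => //; apply/negP; rewrite -ltNge.
rewrite -[r](subrK s) addrC powRD ?(gt_eqF ap) ?implybT// mulrCA mulrC.
rewrite ltr_pM2l ?powR_gt0//.
apply: (@lt_le_trans _ _ (c * (`|C| / c + 1))).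
  by rewrite mulrDr mulrCA divff ?gt_eqF// !mulr1; have := ler_norm C; lra.
rewrite ler_pM2l// -[leLHS](@powRVK _ _ (r - s)) ?gt_eqF//.
by apply: ge0_ler_powR; rewrite ?nnegrE ?(ltW sr0) ?(ltW ap)// /a -/b; lra.
Qed.

Lemma exists_exp4_ge (B : R) : exists k, B <= 4 ^+ k.
Proof.
exists (Num.truncn `|B|).+1; apply: (le_trans (ler_norm B)).
have /andP[_ /ltW/le_trans] := truncn_itv (normr_ge0 B); apply.
by rewrite -natrX ler_nat ltnW// ltn_expl.
Qed.

Lemma le_exp4D (B : R) (k0 k : nat) : B <= 4 ^+ k0 -> B <= 4 ^+ (k + k0).
Proof. by move=> /le_trans; apply; rewrite ler_eXn2l ?leq_addl// ltr1n. Qed.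

(** Rounds the desired real number of steps to an integer at the cost of a factor 2. *)
Lemma half_le_truncn (z : R) : 2 <= z -> z / 2 <= (Num.truncn z)%:R <= z.
Proof.
move=> z2; have z0 : 0 <= z by lra.
by have /andP[-> +] := truncn_itv z0; rewrite -natr1 => ?; lra.
Qed.

End Asymptotics.

(** * Matuszewska-Orlicz and Boyd indices of the construction *)

Section BlockPhiIndices.
Context {R : realType}.
Local Open Scope classical_set_scope.
Variables (p q : R).
Hypotheses (p0 : 0 < p) (pq : p < q).
Local Notation G := (block_phi p q).

Let q0 : 0 < q. Proof. exact: lt_trans pq. Qed.
Let GP : power_growth p q G. Proof. exact: power_growth_block_phi. Qed.

(** The slope-[p] block starting at [4 ^ k] has length [4 ^ k], which exceeds [ln a] or equals it
    for large [k]. *)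
Lemma block_phi_flat_ex (a : R) : 1 <= a ->
  exists2 t, 0 < t & G (a * t) = a `^ p * G t.
Proof.
move=> a1; have [k ak] := exists_exp4_ge (ln a).
exists (expR (4 ^+ k)); first exact: expR_gt0.
by apply: (@block_phi_flat _ p q k); rewrite ?expR_gt0// expRK; lra.
Qed.

Lemma block_phi_rise_ex (a : R) : 1 <= a ->
  exists2 t, 0 < t & G (a * t) = a `^ q * G t.
Proof.
move=> a1; have [k ak] := exists_exp4_ge (ln a).
exists (expR (2 * 4 ^+ k)); first exact: expR_gt0.
have k0 : 0 < 4 ^+ k :> R by rewrite exprn_gt0.
by apply: (@block_phi_rise _ p q k); rewrite ?expR_gt0// expRK ?exprS; lra.
Qed.

Lemma MO_lower_block_phi : MO_lower G = p%:E.
Proof.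
have [_ G_gt0 low _] := GP.
apply/eqP; rewrite eq_le; apply/andP; split; last first.
  apply: ereal_sup_ubound; exists p => //=; exists 1 => // t a t0 a1.
  by rewrite mul1r low// ltW.
apply/ereal_supP => _ [r [c c0 h] <-]; rewrite lee_fin.
apply: (@powR_le_asymptotic _ c 1 _ _ 1) => // a _ a1.
have [t t0 Gat] := block_phi_flat_ex (ltW a1).
by rewrite mul1r -(ler_pM2r (G_gt0 _ t0)) -Gat h// ltW.
Qed.

Lemma MO_upper_block_phi : MO_upper G = q%:E.
Proof.
have [_ G_gt0 _ up] := GP.
apply/eqP; rewrite eq_le; apply/andP; split.
  apply: ereal_inf_lbound; exists q => //=; exists 1 => t a t0 a1.
  by rewrite mul1r up// ltW.
apply: le_ereal_inf_tmp => _ [r [c h] <-]; rewrite lee_fin.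
apply: (@powR_le_asymptotic _ 1 c _ _ 1) => // a _ a1.
have [t t0 Gat] := block_phi_rise_ex (ltW a1).
by rewrite mul1r -(ler_pM2r (G_gt0 _ t0)) -Gat h// ltW.
Qed.

(** Provides the geometric growth of heights required by [dil_norm_ge]. *)
Lemma block_phi_double (v w r : R) : 0 < r -> ln 2 <= p * (w - v) ->
  2 * G (expR v * r) <= G (expR w * r).
Proof.
move=> r0 vw; have l2 : 0 < ln (2 : R) by rewrite ln_gt0// ltr1n.
have wv : 0 <= w - v by rewrite -(pmulr_rge0 _ p0); lra.
have a1 : 1 <= expR (w - v) by rewrite -expR0 ler_expR.
have vr : 0 <= expR v * r by rewrite mulr_ge0 ?expR_ge0// ltW.
have -> : expR w * r = expR (w - v) * (expR v * r) by rewrite mulrA -expRD subrK.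
case: GP => _ _ low _; apply: le_trans (low _ _ vr a1).
apply: ler_wpM2r; first exact: (power_growth_ge0 GP).
by rewrite -[leLHS]lnK ?posrE// /powR gt_eqF ?expR_gt0// expRK ler_expR.
Qed.

(** The 8 combines the 4 of [dil_norm_ge] with the 2 lost in rounding [N] to an integer:
    [4 * D ^ p = b ^ q / 2 <= N]. *)
Lemma dil_norm_block_phi_contract (b : R) : 1 < b -> 8 <= b `^ q ->
  (((b `^ q / 8) `^ p^-1)%:E <= dil_norm (L1G_norm G) b^-1)%E.
Proof.
move=> b1 bq8; have b0 := lt_trans ltr01 b1.
set D := _ `^ p^-1.
have z1 : 1 <= b `^ q / 8 by lra.
have Dp : D `^ p = b `^ q / 8 by rewrite powRVK ?gt_eqF//; lra.
have D0 : 0 < D by rewrite powR_gt0; lra.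
have D1 : 1 <= D.
  have pi0 : 0 <= p^-1 by rewrite invr_ge0 ltW.
  have := @ge0_ler_powR R _ pi0 1 (b `^ q / 8).
  by rewrite powR1 !nnegrE; apply => //; lra.
(* From index [k0] on, each block has room for the factors [D] and [b], and consecutive heights at
   least double [G]. *)
have [k0] := exists_exp4_ge (Num.max (ln D) (Num.max (ln b) (ln 2 / p))).
rewrite !ge_max => /and3P[kD kb k2].
have /andP[N1 N2] : b `^ q / 2 <= (Num.truncn (b `^ q))%:R <= b `^ q.
  by apply: half_le_truncn; lra.
have N0 : (0 < Num.truncn (b `^ q))%N by rewrite -(ltr0n R); lra.
(* Here a slope-[p] block ends and a slope-[q] block begins: division by [D] sees slope [p],
   multiplication by [b] sees slope [q]. *)
pose u k : R := expR (2 * 4 ^+ (k + k0)).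
have u0 k : 0 < u k by exact: expR_gt0.
have G0 k : 0 < G (u k) by exact: block_phi_gt0.
have flat k : G (u k) = D `^ p * G (u k / D).
  have uD : 0 < u k / D by rewrite divr_gt0.
  have lnuD : ln (u k / D) = 2 * 4 ^+ (k + k0) - ln D.
    by rewrite ln_div ?posrE// expRK.
  have kD' := le_exp4D k kD.
  rewrite -(@block_phi_flat _ p q (k + k0)) ?lnuD//; first last.
  - by lra.
  - by lra.
  by rewrite mulrC divfK ?gt_eqF.
have rise k : G (b * u k) = b `^ q * G (u k).
  have kb' := le_exp4D k kb.
  have e0 : 0 < 4 ^+ (k + k0) :> R by rewrite exprn_gt0.
  by apply: (@block_phi_rise _ p q (k + k0));
    rewrite ?(ltW b1)// expRK ?exprS; lra.
apply: (@dil_norm_ge _ p q G p0 q0 GP (Num.truncn (b `^ q)) (fun k => b * u k) u)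
  => //= [k||k|k|k].
- by rewrite mulr_gt0.
- by rewrite invr_gt0.
- apply: block_phi_double; rewrite ?invr_gt0// -ler_pdivrMl// mulrC.
  have e0 : 0 < 4 ^+ (k + k0) :> R by rewrite exprn_gt0.
  have := le_exp4D k k2; rewrite addSn exprS; lra.
- by rewrite rise mulrC ler_pM2r.
- rewrite mulKf ?gt_eqF// flat Dp.
  have : 0 < G (u k / D) by apply: block_phi_gt0; rewrite divr_gt0.
  by nra.
Qed.

(** [dil_norm_ge] is applied with [D^-1], where [D ^ q = 8 * a ^ p]. The number of steps is [D ^ q]
    rounded, which stays at least [4 * a ^ p]. *)
Lemma dil_norm_block_phi_dilate (a : R) : 1 < a ->
  (((8 * a `^ p) `^ (- q^-1))%:E <= dil_norm (L1G_norm G) a)%E.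
Proof.
move=> a1; have a0 := lt_trans ltr01 a1; rewrite powRN.
set D := _ `^ q^-1.
have ap1 : 1 < a `^ p by rewrite powR_gt1.
have Dq : D `^ q = 8 * a `^ p by rewrite powRVK ?gt_eqF//; lra.
have D0 : 0 < D by rewrite powR_gt0; lra.
have D1 : 1 <= D by rewrite ltW// powR_gt1 ?invr_gt0//; lra.
have [k0] := exists_exp4_ge (Num.max (ln D) (Num.max (ln a) (ln 2 / p))).
rewrite !ge_max => /and3P[kD ka k2].
have /andP[N1 N2] : 8 * a `^ p / 2 <= (Num.truncn (8 * a `^ p))%:R <= 8 * a `^ p.
  by apply: half_le_truncn; lra.
have N0 : (0 < Num.truncn (8 * a `^ p))%N by rewrite -(ltr0n R); lra.
(* Here a slope-[q] block ends and a slope-[p] block begins: division by [D] sees slope [q],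
   multiplication by [a] sees slope [p]. *)
pose u k : R := expR (4 ^+ (k + k0).+1).
have u0 k : 0 < u k by exact: expR_gt0.
have G0 k : 0 < G (u k) by exact: block_phi_gt0.
have rise k : G (u k) = D `^ q * G (u k / D).
  have uD : 0 < u k / D by rewrite divr_gt0.
  have lnuD : ln (u k / D) = 4 ^+ (k + k0).+1 - ln D.
    by rewrite ln_div ?posrE// expRK.
  have kD' := le_exp4D k kD.
  have e0 : 0 < 4 ^+ (k + k0) :> R by rewrite exprn_gt0.
  rewrite -(@block_phi_rise _ p q (k + k0)) ?lnuD//; first last.
  - by lra.
  - by rewrite exprS; lra.
  by rewrite mulrC divfK ?gt_eqF.
have flat k : G (a * u k) = a `^ p * G (u k).
  have ka' := le_exp4D k ka.
  have e0 : 0 < 4 ^+ (k + k0) :> R by rewrite exprn_gt0.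
  by apply: (@block_phi_flat _ p q (k + k0).+1);
    rewrite ?(ltW a1)// expRK ?exprS; lra.
apply: (@dil_norm_ge _ p q G p0 q0 GP (Num.truncn (8 * a `^ p)) u (fun k => u k / D))
  => //= [k||k|k|k].
- by rewrite divr_gt0.
- by rewrite invr_gt0.
- rewrite invrK !divfK ?gt_eqF//.
  have := @block_phi_double (4 ^+ (k + k0).+1) (4 ^+ (k.+1 + k0).+1) 1 ltr01.
  rewrite !mulr1; apply; rewrite -ler_pdivrMl// mulrC.
  have e0 : 0 < 4 ^+ (k + k0) :> R by rewrite exprn_gt0.
  have := le_exp4D k k2; rewrite addSn !exprS; lra.
- by rewrite rise Dq mulrC ler_pM2r// block_phi_gt0// divr_gt0.
- by rewrite invrK divfK ?gt_eqF// flat mulrA mulrC ler_pM2l//; lra.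
Qed.

Lemma boyd_lower_block_phi : boyd_lower (L1G_norm G) = (p / q)%:E.
Proof.
apply/eqP; rewrite eq_le; apply/andP; split; last first.
  apply: ereal_sup_ubound; exists (p / q) => //=; split; first by rewrite divr_gt0.
  exists 1 => a a0 a1; apply: (le_trans (dil_norm_le p0 q0 GP a0)).
  by rewrite /dil_bound (ltW a1) invf_div mul1r.
apply/ereal_supP => _ [r [r0 [c h]] <-]; rewrite lee_fin.
have : q / p <= r^-1.
  (* Powers of [b = 1 / a] are compared; beyond [8 ^ (1 / q)] the condition [8 <= b ^ q] of the
     lower bound holds. *)
  apply: (@powR_le_asymptotic _ (8^-1 `^ p^-1) c _ _ (8 `^ q^-1)).
    by rewrite powR_gt0// invr_gt0.
  move=> b b8 b1; have b0 := lt_trans ltr01 b1.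
  rewrite -lee_fin.
  have bi : 0 < b^-1 by rewrite invr_gt0.
  have bi1 : b^-1 < 1 by rewrite invf_lt1.
  have -> : c * b `^ r^-1 = c * b^-1 `^ (- r^-1).
    by rewrite -mulN1r powRrM powR_inv1 ?(ltW bi)// invrK.
  apply: le_trans (h _ bi bi1).
  have -> : 8^-1 `^ p^-1 * b `^ (q / p) = (b `^ q / 8) `^ p^-1.
    by rewrite powRM ?powR_ge0 ?invr_ge0// -powRrM mulrC.
  apply: dil_norm_block_phi_contract => //.
  rewrite -[leLHS](@powRVK _ _ q) ?gt_eqF//.
  by apply: ge0_ler_powR; rewrite ?nnegrE ?powR_ge0 ?(ltW q0) ?(ltW b0) ?(ltW b8).
by rewrite -invf_div lef_pV2 ?posrE ?divr_gt0.
Qed.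

Lemma boyd_upper_block_phi : boyd_upper (L1G_norm G) = (q / p)%:E.
Proof.
apply/eqP; rewrite eq_le; apply/andP; split.
  apply: ereal_inf_lbound; exists (q / p) => //=; split; first by rewrite divr_gt0.
  exists 1 => a a1; have a0 := lt_trans ltr01 a1.
  apply: (le_trans (dil_norm_le p0 q0 GP a0)).
  by rewrite /dil_bound (lt_geF a1) invf_div mul1r.
apply: le_ereal_inf_tmp => _ [r [r0 [c h]] <-]; rewrite lee_fin.
have : - (p / q) <= - r^-1.
  apply: (@powR_le_asymptotic _ (8 `^ (- q^-1)) c _ _ 1); first by rewrite powR_gt0.
  move=> a _ a1; have a0 := lt_trans ltr01 a1.
  rewrite -lee_fin; apply: le_trans (h _ a1).
  have -> : 8 `^ (- q^-1) * a `^ (- (p / q)) = (8 * a `^ p) `^ (- q^-1).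
    by rewrite powRM ?powR_ge0// -powRrM mulrN.
  exact: dil_norm_block_phi_dilate.
by rewrite lerN2 -[leRHS]invf_div lef_pV2 ?posrE ?divr_gt0.
Qed.

End BlockPhiIndices.

Theorem theorem4p1 (R : realType) (p q : R) :
  0 < p -> p < q ->
  exists G : R -> R,
    [/\ phi_function G,
        MO_lower G = (p%:E)%E,
        MO_upper G = (q%:E)%E,
        boyd_lower (L1G_norm G) = ((p / q)%:E)%E &
        boyd_upper (L1G_norm G) = ((q / p)%:E)%E].
Proof.
move=> p0 pq; have q0 := lt_trans p0 pq.
exists (block_phi p q); split.
- exact: (power_growth_phi_function p0 q0 (power_growth_block_phi pq)).
- exact: MO_lower_block_phi.
- exact: MO_upper_block_phi.
- exact: boyd_lower_block_phi.
- exact: boyd_upper_block_phi.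
Qed.
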